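(* Let $f(z)=\sum_{j=0}^{\infty}a_{j}z^{j}$, $a_j\in\mathbb{R}$, be a real entire function, and suppose that $f$ has the Weierstrass factorization $$f(z)=z^{p}e^{Bz+C}\prod_{j}\left(1-\frac{z}{z_{j}}\right)e^{z/z_{j}},$$ where $p\ge 0$ is an integer, $B\in\mathbb{R}$ and $C\in\mathbb{C}$ are constants, and $(z_j)$ is the (finite or infinite) list of the nonzero zeros of $f$, repeated according to multiplicity. Suppose that $2\pi/3<|\operatorname{Arg} z_j|\le\pi$ for all $j$, that $\sum_{j}1/|z_{j}|$ converges, and that $B+\sum_{j}\frac{1}{z_{j}}>0$. Then for every integer $r$ with $0\le r<3$, every complex zero $z$ of the entire function $$f_{r}(z)=\sum_{j\equiv r \pmod 3}a_{j}z^{j}$$ lies on the $3$ radial rays given by $\operatorname{Im} z^{3}=0$ and $\operatorname{Re} z^{3}\le 0$.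
   Context: $\operatorname{Arg}$ denotes the principal argument of a nonzero complex number, with $-\pi<\operatorname{Arg} z\le\pi$. In $f_r$ the sum runs over all integers $j\ge0$ with $j\equiv r\pmod 3$. Because $f$ is real, its zeros are symmetric under complex conjugation with multiplicity, so $\sum_j 1/z_j$ is real. If the list $(z_j)$ is finite (or empty), the product and sums are finite (or empty). *)

(* Defs.v *)
From HB Require Import structures.
From mathcomp Require Import all_boot all_order all_algebra.
From mathcomp Require Import complex.
From mathcomp Require Import all_classical all_reals all_analysis.

Set Implicit Arguments.
Unset Strict Implicit.
Unset Printing Implicit Defensive.

Import Order.TTheory GRing.Theory Num.Theory.
Import numFieldNormedType.Exports.

Local Open Scope classical_set_scope.
Local Open Scope ring_scope.
Local Open Scope complex_scope.
Local Open Scope card_scope.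

(* [R[i]^o] is [R[i]] with the topology of its modulus; all limits of complex
   sequences below are taken there. *)

Definition pseriesC (R : realType) (c : nat -> R[i]) (z : R[i]) : nat -> R[i]^o :=
  series (fun j => c j * z ^+ j : R[i]^o).

Definition entire_coef (R : realType) (c : nat -> R[i]) : Prop :=
  forall z : R[i], cvgn (pseriesC c z).

Definition psumC (R : realType) (c : nat -> R[i]) (z : R[i]) : R[i] :=
  limn (pseriesC c z).

Definition realcoef (R : realType) (a : nat -> R) : nat -> R[i] :=
  fun j => (a j)%:C.

Definition section_coef (R : realType) (m r : nat) (a : nat -> R) : nat -> R :=
  fun j => if j == r %[mod m] then a j else 0.

Definition expC (R : realType) (z : R[i]) : R[i] :=
  (expR (complex.Re z) * cos (complex.Im z)) +i* (expR (complex.Re z) * sin (complex.Im z)).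

(* The principal argument, with values in ]-pi, pi]; the value at 0 is
   meaningless. *)
Definition Arg (R : realType) (z : R[i]) : R :=
  let t := acos (complex.Re z / ComplexField.Normc.normc z) in if 0 <= complex.Im z then t else - t.

(* The zero at [w] of the entire function with Taylor coefficients [c] at 0 has
   multiplicity exactly [m]; [m = 0] means that [w] is not a zero. *)
Definition zero_multiplicity (R : realType) (c : nat -> R[i]) (w : R[i])
    (m : nat) : Prop :=
  exists g : nat -> R[i],
    [/\ entire_coef g, psumC g w != 0 &
        forall z, psumC c z = (z - w) ^+ m * psumC g z].

(* A finite or infinite list of complex numbers is a pair of
   [N : option nat] and [u : nat -> R[i]]: the entries are the [u j] with
   [j < n] when [N = Some n], and all the [u j] when [N = None]. *)
Definition in_list (N : option nat) : pred nat :=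
  fun j => if N is Some n then (j < n)%N else true.

Definition list_sum (R : realType) (N : option nat) (u : nat -> R[i]) :
    nat -> R[i]^o :=
  fun n => \sum_(0 <= j < n | in_list N j) u j.

Definition list_prod (R : realType) (N : option nat) (u : nat -> R[i]) :
    nat -> R[i]^o :=
  fun n => \prod_(0 <= j < n | in_list N j) u j.

(* The list enumerates the nonzero zeros of the entire function with Taylor
   coefficients [c], each repeated according to its multiplicity. *)
Definition lists_nonzero_zeros (R : realType) (c : nat -> R[i])
    (N : option nat) (zs : nat -> R[i]) : Prop :=
  (forall j, in_list N j -> zs j != 0) /\
  (forall w : R[i], w != 0 ->
     exists2 m : nat, zero_multiplicity c w m &
       [set j | in_list N j /\ zs j = w] #= `I_m).

(* The genus 1 factor of the zero [w], as a function of [z]. *)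
Definition primary_factor (R : realType) (w z : R[i]) : R[i] :=
  (1 - z / w) * expC (z / w).

(* Main.v *)
Require Import Defs.
From HB Require Import structures.
From mathcomp Require Import all_boot all_order all_algebra.
From mathcomp Require Import complex.
From mathcomp Require Import all_classical all_reals all_analysis.
From mathcomp Require Import ring lra.

Set Implicit Arguments.
Unset Strict Implicit.
Unset Printing Implicit Defensive.
Import Order.TTheory GRing.Theory Num.Theory.
Import numFieldNormedType.Exports.
Local Open Scope classical_set_scope.
Local Open Scope ring_scope.
Local Open Scope complex_scope.

(** Write [x = z ^+ 3] and let [w_0], [w_1], [w_2] be the three cube roots of [x].
    Up to the factor [3 z^(3 - r)], the section [f_r] at [z] is the moment
    [P_(3-r)], where [P_j = \sum_k f (w_k) w_k^j] ([moment_section]).  These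
    moments satisfy [P_(j+3) = x P_j], and multiplying [f] by
    [1 + p z + q z^2] replaces [P_j] by [P_j + p P_(j+1) + q P_(j+2)].  So for a
    fixed [x] everything happens in a three-dimensional space, and one looks for
    a closed cone of sequences [P] that is invariant under the factors of [f].

    If [Im x > 0], the cone is that of the sequences whose successive terms turn
    counterclockwise, [P_j], [P_(j+1)], [P_(j+2)] and [P_(j+3) = x P_j] being met
    in this order ([sector_cone]).  It contains the moments of the constant 1,
    and it is invariant under [1 + p z + q z^2] when [p, q >= 0] and
    [q <= p ^+ 2] ([sector_quad]).  The quadratic factor with conjugate zeros
    [c], [c^*] satisfies this condition exactly when [Re c <= 0] and
    [|c| <= 2 |Re c|], which is where the sector [2 pi / 3 <= |Arg c|] comes
    from.  If [x > 0], the cone of nonnegative sequences does the same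
    ([real_cone]).

    Because [\sum 1 / |z_j|] converges, [f] is a limit of products of a
    power of [z], a constant, an exponential [e^(b_n z)] with real [b_n], and
    linear factors whose zeros are symmetric under conjugation: the first [n]
    zeros are completed by finitely many later ones, whose contribution tends to 1
    ([conjugate_completion], [tail_prod_cvg1]).  The exponents [b_n] tend to
    [beta = B + \sum 1 / z_j > 0], and [e^(b z)] with [b >= 0] preserves the cone
    by Euler's limit [(1 + b z / n)^n].  Hence the moments of [e^(s z) f], up to a
    constant, lie in the cone for every [s > - beta] ([factorized_stable]).

    The room given by [beta > 0] turns weak inequalities into nonvanishing.  If
    [P_j = 0], differentiate the inequalities for [e^(- s z) f] at [s = 0], where
    one of them is an equality: since the derivative of [P_j] is [- P_(j+1)],
    this forces [P_(j+1) = 0] ([cone_strict]).  So all [P_j] vanish, hence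
    [f (w_k) = 0] for all [k].  But the nonzero zeros of [f] have negative real
    part, whereas [w_0 + w_1 + w_2 = 0].  The case [Im x < 0] follows by conjugation. *)

Local Notation normc := ComplexField.Normc.normc.
Local Notation Re := (@complex.Re _).
Local Notation Im := (@complex.Im _).

(** * Limits of complex sequences *)

(** Convergence by components, so that real limit theorems apply; [cvgCP] relates it
    to the topology of the modulus. *)
Definition cvgC (R : realType) (u : nat -> R[i]) (l : R[i]) : Prop :=
  (fun n => Re (u n)) @ \oo --> Re l /\ (fun n => Im (u n)) @ \oo --> Im l.

Section ComplexLimits.
Variable R : realType.
Implicit Types (u v : nat -> R[i]) (l m x y : R[i]).

Lemma norm_normcE x : `|x| = (normc x)%:C.
Proof. by rewrite normc_def; case: x. Qed.

Lemma normc_ge0 x : 0 <= normc x.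
Proof. by case: x => a b; exact: sqrtr_ge0. Qed.

Lemma ger_normRe x : `|Re x| <= normc x.
Proof.
case: x => a b /=; rewrite -sqrtr_sqr ler_wsqrtr // lerDl sqr_ge0 //.
Qed.

Lemma ger_normIm x : `|Im x| <= normc x.
Proof.
case: x => a b /=; rewrite -sqrtr_sqr ler_wsqrtr // lerDr sqr_ge0 //.
Qed.

Lemma normc_le_ReIm x : normc x <= `|Re x| + `|Im x|.
Proof.
case: x => a b /=.
have := le_normcD a%:C (0 +i* b).
by simpc => /=; rewrite expr0n /= addr0 add0r !sqrtr_sqr.
Qed.

Lemma normcX x n : normc (x ^+ n) = normc x ^+ n.
Proof.
elim: n => [|n ih]; first by rewrite !expr0 ComplexField.Normc.normc1.
by rewrite !exprS ComplexField.Normc.normcM ih.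
Qed.

Lemma ReD x y : Re (x + y) = Re x + Re y. Proof. by case: x; case: y. Qed.
Lemma ImD x y : Im (x + y) = Im x + Im y. Proof. by case: x; case: y. Qed.
Lemma ReN x : Re (- x) = - Re x. Proof. by case: x. Qed.
Lemma ImN x : Im (- x) = - Im x. Proof. by case: x. Qed.
Lemma ReM x y : Re (x * y) = Re x * Re y - Im x * Im y.
Proof. by case: x; case: y. Qed.
Lemma ImM x y : Im (x * y) = Re x * Im y + Im x * Re y.
Proof. by case: x => a b; case: y. Qed.
Lemma ReJ x : Re (x^*) = Re x. Proof. by case: x. Qed.
Lemma ImJ x : Im (x^*) = - Im x. Proof. by case: x. Qed.

Lemma cvgC_cst l : cvgC (fun=> l) l.
Proof. by split; exact: cvg_cst. Qed.

Lemma cvgCD u v l m : cvgC u l -> cvgC v m -> cvgC (fun n => u n + v n) (l + m).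
Proof.
move=> [ul1 ul2] [vm1 vm2]; split.
  by under eq_fun do rewrite ReD; rewrite ReD; exact: cvgD.
by under eq_fun do rewrite ImD; rewrite ImD; exact: cvgD.
Qed.

Lemma cvgCN u l : cvgC u l -> cvgC (fun n => - u n) (- l).
Proof.
move=> [ul1 ul2]; split.
  by under eq_fun do rewrite ReN; rewrite ReN; exact: cvgN.
by under eq_fun do rewrite ImN; rewrite ImN; exact: cvgN.
Qed.

Lemma cvgCM u v l m : cvgC u l -> cvgC v m -> cvgC (fun n => u n * v n) (l * m).
Proof.
move=> [ul1 ul2] [vm1 vm2]; split.
  under eq_fun do rewrite ReM; rewrite ReM.
  by apply: cvgB; exact: cvgM.
under eq_fun do rewrite ImM; rewrite ImM.
by apply: cvgD; exact: cvgM.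
Qed.

Lemma cvgCJ u l : cvgC u l -> cvgC (fun n => (u n)^*) (l^*).
Proof.
move=> [ul1 ul2]; split.
  by under eq_fun do rewrite ReJ; rewrite ReJ.
by under eq_fun do rewrite ImJ; rewrite ImJ; exact: cvgN.
Qed.

Lemma cvgCMl c u l : cvgC u l -> cvgC (fun n => c * u n) (c * l).
Proof. by move=> ul; apply: cvgCM => //; exact: cvgC_cst. Qed.

Lemma cvgCX u l k : cvgC u l -> cvgC (fun n => u n ^+ k) (l ^+ k).
Proof.
move=> ul; elim: k => [|k ih]; first by rewrite expr0; exact: cvgC_cst.
rewrite exprS; under eq_fun do rewrite exprS.
exact: cvgCM.
Qed.

Lemma cvgC_sum (I : Type) (r : seq I) (u : I -> nat -> R[i]) (l : I -> R[i]) :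
  (forall i, cvgC (u i) (l i)) ->
  cvgC (fun n => \sum_(i <- r) u i n) (\sum_(i <- r) l i).
Proof.
move=> ul; elim: r => [|i r ih].
  by rewrite big_nil; under eq_fun do rewrite big_nil; exact: cvgC_cst.
rewrite big_cons; under eq_fun do rewrite big_cons.
exact: cvgCD.
Qed.

Lemma cvgC_unique u l m : cvgC u l -> cvgC u m -> l = m.
Proof.
move=> [l1 l2] [m1 m2]; apply/eqP; rewrite eq_complex; apply/andP; split; apply/eqP.
  exact: (cvg_unique _ l1 m1).
exact: (cvg_unique _ l2 m2).
Qed.

Lemma cvgC_normP u l : cvgC u l <-> (fun n => normc (u n - l)) @ \oo --> 0.
Proof.
split=> [ul|u0].
  have [c1 c2] : cvgC (fun n => u n - l) (l - l).
    by apply: cvgCD => //; exact: cvgC_cst.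
  apply: (@squeeze_cvgr _ _ _ _ (fun=> 0)
    (fun n => `|Re (u n - l)| + `|Im (u n - l)|)).
  - by near=> n; rewrite normc_ge0 normc_le_ReIm.
  - exact: cvg_cst.
  - rewrite subrr in c1 c2; rewrite -[X in _ --> X](addr0 0).
    apply: cvgD.
      by rewrite -(normr0 R); exact: (cvg_norm c1).
    by rewrite -(normr0 R); exact: (cvg_norm c2).
split.
  apply/cvgrPdist_le => e e0.
  move/cvgrPdist_le : u0 => /(_ e e0); apply: filterS => n.
  rewrite sub0r normrN (ger0_norm (normc_ge0 _)); apply: le_trans.
  by rewrite distrC -ReN -ReD; exact: ger_normRe.
apply/cvgrPdist_le => e e0.
move/cvgrPdist_le : u0 => /(_ e e0); apply: filterS => n.
rewrite sub0r normrN (ger0_norm (normc_ge0 _)); apply: le_trans.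
by rewrite distrC -ImN -ImD; exact: ger_normIm.
Unshelve. all: by end_near. Qed.

Lemma cvgC_dominated u l (e : nat -> R) :
  (\forall n \near \oo, normc (u n - l) <= e n) -> e @ \oo --> 0 -> cvgC u l.
Proof.
move=> ue e0; apply/cvgC_normP.
apply: (@squeeze_cvgr _ _ _ _ (fun=> 0) e) => //; last exact: cvg_cst.
by apply: filterS ue => n ->; rewrite normc_ge0.
Qed.

Lemma cvgCP (u : nat -> R[i]^o) (l : R[i]^o) : u @ \oo --> l <-> cvgC u l.
Proof.
split=> [/cvgrPdist_lt ul|/cvgC_normP/cvgrPdist_lt ul].
  apply/cvgC_normP/cvgrPdist_lt => e e0.
  have /ul : 0 < (e%:C : R[i]) by rewrite ltcR.
  apply: filterS => n; rewrite norm_normcE ltcR => h.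
  rewrite sub0r normrN ger0_norm ?normc_ge0 //.
  by rewrite -normcN opprB.
apply/cvgrPdist_lt => -[er ei]; rewrite ltcE /= => /andP[/eqP -> er0].
move: (ul _ er0); apply: filterS => n.
rewrite sub0r normrN ger0_norm ?normc_ge0 // => h.
by rewrite norm_normcE ltcR -normcN opprB.
Qed.

Lemma cvgC_limn (u : nat -> R[i]^o) : cvgn u -> cvgC u (limn u).
Proof. by move=> /cvgCP. Qed.

Lemma limn_cvgC (u : nat -> R[i]^o) l : cvgC u l -> limn u = l.
Proof. by move=> /cvgCP ul; apply: cvg_lim => //; exact: norm_hausdorff. Qed.

End ComplexLimits.

(** * The complex exponential *)

Section ComplexExponential.
Variable R : realType.
Implicit Types (w x y : R[i]).

Lemma expC0 : expC (0 : R[i]) = 1.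
Proof. by rewrite /expC /= expR0 cos0 sin0 mulr1 mulr0. Qed.

Lemma expCD x y : expC (x + y) = expC x * expC y.
Proof.
case: x => a b; case: y => c d.
apply/eqP; rewrite eq_complex /expC /= expRD cosD sinD; apply/andP; split; apply/eqP; ring.
Qed.

Lemma expC_neq0 x : expC x != 0.
Proof.
apply/eqP => x0; have := expCD x (- x).
by rewrite x0 mul0r subrr expC0 => /eqP; rewrite oner_eq0.
Qed.

Lemma expCMn x n : expC (x *+ n) = expC x ^+ n.
Proof. by elim: n => [|n ih]; rewrite ?mulr0n ?expC0 // mulrS expCD ih exprS. Qed.

Lemma normc_expC x : normc (expC x) = expR (Re x).
Proof.
rewrite /expC /= !exprMn -mulrDr cos2Dsin2 mulr1 sqrtr_sqr ger0_norm //.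
Qed.

Lemma expC_cvg (u : nat -> R[i]) w : cvgC u w -> cvgC (fun n => expC (u n)) (expC w).
Proof.
move=> [u1 u2]; split => /=; apply: cvgM.
- exact: (continuous_cvg _ (@continuous_expR R _) u1).
- exact: (continuous_cvg _ (@continuous_cos R _) u2).
- exact: (continuous_cvg _ (@continuous_expR R _) u1).
- exact: (continuous_cvg _ (@continuous_sin R _) u2).
Qed.

Lemma cvg_harmonic_slope (f : R -> R) (d : R) :
  is_derive (0 : R) (1 : R) f d ->
  (fun n => n.+1%:R * (f n.+1%:R^-1 - f 0)) @ \oo --> d.
Proof.
move=> fd; have := @ex_derive _ _ _ _ _ _ _ fd; have <- := @derive_val _ _ _ _ _ _ _ fd.
move=> /cvg_ex[l fl].
have fl' : 'D_1 f 0 = l by exact: cvg_lim fl.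
rewrite fl'.
move=> A /fl nA.
have /(@cvg_harmonic R) : nbhs (0 : R)
    [set t | t != 0 -> A (t^-1 *: ((f \o shift 0) (t *: 1) - f 0))].
  exact: nA.
move=> h.
suff: \forall n \near \oo, A (n.+1%:R * (f n.+1%:R^-1 - f 0)) by [].
near=> n.
have n0 : n.+1%:R^-1 != 0 :> R by rewrite invr_eq0 pnatr_eq0.
have : n.+1%:R^-1 != 0 :> R ->
    A ((n.+1%:R^-1)^-1 *: ((f \o shift 0) (n.+1%:R^-1 *: 1) - f 0)).
  by near: n.
move=> /(_ n0) /=; rewrite invrK.
by rewrite /GRing.scale /= mulr1 addr0.
Unshelve. all: by end_near.
Qed.

(** The derivative of the exponential at 0 along the direction [w], on the
    sequence [1 / n]; it serves both Euler's formula and the strictness argument,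
    which differentiates [expC (- s z) f] at [s = 0]. *)
Lemma expC_slope w :
  cvgC (fun n => n.+1%:R * (expC (w / n.+1%:R) - 1)) w.
Proof.
case: w => a b.
have E n : (a +i* b) / n.+1%:R = (a * n.+1%:R^-1) +i* (b * n.+1%:R^-1).
  have -> : (n.+1%:R^-1 : R[i]) = (n.+1%:R^-1)%:C by rewrite fmorphV rmorph_nat.
  by apply/eqP; rewrite eq_complex /=; apply/andP; split; apply/eqP; ring.
have N n (c d : R) : n.+1%:R * (c +i* d - 1) = (n.+1%:R * (c - 1)) +i* (n.+1%:R * d).
  have -> : (n.+1%:R : R[i]) = (n.+1%:R)%:C by rewrite rmorph_nat.
  by apply/eqP; rewrite eq_complex /=; apply/andP; split; apply/eqP; ring.
split.
  under eq_fun do rewrite E /expC N /=.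
  have fd : is_derive (0 : R) (1 : R) (fun t : R => expR (a * t) * cos (b * t)) a.
    apply: is_derive_eq.
    rewrite !mulr0 expR0 cos0 sin0 /GRing.scale /=; ring.
  have := cvg_harmonic_slope fd.
  by rewrite !mulr0 expR0 cos0 mulr1.
under eq_fun do rewrite E /expC N /=.
have fd : is_derive (0 : R) (1 : R) (fun t : R => expR (a * t) * sin (b * t)) b.
  apply: is_derive_eq.
  rewrite !mulr0 expR0 cos0 sin0 /GRing.scale /=; ring.
have := cvg_harmonic_slope fd.
by rewrite !mulr0 expR0 sin0 mulr0; under eq_fun do rewrite subr0.
Qed.

Lemma normc_subX (x y : R[i]) (M : R) n : normc x <= M -> normc y <= M ->
  normc (x ^+ n.+1 - y ^+ n.+1) <= n.+1%:R * M ^+ n * normc (x - y).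
Proof.
move=> xM yM; have M0 : 0 <= M := le_trans (normc_ge0 _) xM.
elim: n => [|n ih]; first by rewrite !expr1 expr0 !mul1r.
have -> : x ^+ n.+2 - y ^+ n.+2 = x * (x ^+ n.+1 - y ^+ n.+1) + (x - y) * y ^+ n.+1.
  by rewrite !(exprS _ n.+1); ring.
apply: (le_trans (le_normcD _ _)); rewrite !ComplexField.Normc.normcM normcX.
have h1 : normc x * normc (x ^+ n.+1 - y ^+ n.+1) <= M * (n.+1%:R * M ^+ n * normc (x - y)).
  by apply: ler_pM => //; exact: normc_ge0.
have h2 : normc (x - y) * normc y ^+ n.+1 <= normc (x - y) * M ^+ n.+1.
  by apply: ler_wpM2l; [exact: normc_ge0|apply: lerXn2r => //; rewrite nnegrE normc_ge0].
apply: (le_trans (lerD h1 h2)).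
by rewrite le_eqVlt; apply/orP; left; apply/eqP; rewrite -[n.+2%:R]natr1 (exprS M n); ring.
Qed.

(** Euler's formula: the bases [1 + w / n] and [expC (w / n)] have modulus at most
    [expR (normc w / n)], so their [n]-th powers differ by at most
    [expR (normc w)] times [n] times the difference of the bases. *)
Lemma expC_euler w :
  cvgC (fun n => (1 + w / n.+1%:R) ^+ n.+1) (expC w).
Proof.
pose e n := expR (normc w) * normc (n.+1%:R * (expC (w / n.+1%:R) - 1) - w).
apply: (@cvgC_dominated _ _ _ e); last first.
  rewrite -(mulr0 (expR (normc w))); apply: cvgM; first exact: cvg_cst.
  by apply/cvgC_normP; exact: expC_slope.
apply: nearW => n.
have n0 : n.+1%:R != 0 :> R[i] by rewrite pnatr_eq0.
have nR (z : R[i]) : normc (n.+1%:R * z) = n.+1%:R * normc z.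
  rewrite -[n.+1%:R in LHS](rmorph_nat (@real_complex_def R (Phant R))).
  by rewrite ComplexField.Normc.normcM /= expr0n /= addr0 sqrtr_sqr ger0_norm.
have n0R : 0 < n.+1%:R :> R by rewrite ltr0n.
have wn : normc (w / n.+1%:R) = normc w / n.+1%:R.
  by rewrite -{2}[w](divfK n0) (mulrC _ n.+1%:R) nR mulrAC mulfV ?mul1r // gt_eqF.
pose M := expR (normc w / n.+1%:R).
have M1 : normc (1 + w / n.+1%:R) <= M.
  apply: (le_trans (le_normcD _ _)); rewrite ComplexField.Normc.normc1 wn.
  exact: expR_ge1Dx.
have M2 : normc (expC (w / n.+1%:R)) <= M.
  by rewrite normc_expC ler_expR -wn; apply: le_trans (ger_normRe _); exact: ler_norm.
have -> : expC w = expC (w / n.+1%:R) ^+ n.+1.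
  by rewrite -expCMn -(mulr_natr (w / _)) divfK.
apply: (le_trans (normc_subX n M1 M2)).
have Mn : M ^+ n <= expR (normc w).
  rewrite -expRM_natl ler_expR mulrCA ler_piMr ?normc_ge0 //.
  by rewrite ler_pdivrMr // mul1r ler_nat.
rewrite /e mulrAC [leLHS]mulrC; apply: ler_pM => //.
- by rewrite exprn_ge0 // expR_ge0.
- by rewrite mulr_ge0 // normc_ge0.
rewrite -nR -normcN le_eqVlt; apply/orP; left; apply/eqP; congr normc.
have h : n.+1%:R * (w / n.+1%:R) = w by rewrite mulrC divfK.
by rewrite mulrBr mulrDr h; ring.
Qed.

End ComplexExponential.

(** * Cones of moment sequences *)

(** What the argument needs of a set [K] of sequences with [P_(j+3) = x P_j]: it is
    closed, invariant under the factors of [f], and contains the moments of the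
    constant 1, which are 3, 0, 0, and so on.  In [cone_strict], [Pn n] stands for
    the moments of [expC (- z / n.+1) f]: these converge to [P], and when
    [P j = 0] the quotient [n.+1 (Pn n j - P j)] tends to [- P j.+1], the
    derivative at [s = 0] of the [j]-th moment of [expC (- s z) f]. *)
Record section_cone (R : realType) (x : R[i]) (K : (nat -> R[i]) -> Prop) : Prop :=
  SectionCone {
  cone_lim : forall (Pn : nat -> nat -> R[i]) (P : nat -> R[i]),
    (\forall n \near \oo, K (Pn n)) ->
    (forall j, cvgC (fun n => Pn n j) (P j)) -> K P;
  cone_quad : forall (P : nat -> R[i]) (p q : R),
    (forall j, P j.+3 = x * P j) -> K P -> 0 <= p -> 0 <= q -> q <= p ^+ 2 ->
    K (fun j => P j + p%:C * P j.+1 + q%:C * P j.+2);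
  cone_shift : forall P : nat -> R[i], K P -> K (fun j => P j.+1);
  cone_one : forall P : nat -> R[i],
    (forall j, P j.+3 = x * P j) -> P 0%N = 3 -> P 1%N = 0 -> P 2%N = 0 -> K P;
  cone_strict : forall (Pn : nat -> nat -> R[i]) (P : nat -> R[i]) j,
    (forall n i, Pn n i.+3 = x * Pn n i) ->
    (\forall n \near \oo, K (Pn n)) ->
    (forall i, cvgC (fun n => Pn n i) (P i)) ->
    cvgC (fun n => n.+1%:R * Pn n j) (- P j.+1) -> P j.+1 = 0 }.

(** One turns counterclockwise, by at most a half circle, from [P j] to [P j.+1] and
    from [P j] to [P j.+2].  The same holds from [P j] to [P j.+3] when
    [P j.+3 = x * P j] and [0 <= Im x]. *)
Definition sector_cone (R : realType) (P : nat -> R[i]) : Prop :=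
  forall j, 0 <= Im (P j.+1 * (P j)^*) /\ 0 <= Im (P j.+2 * (P j)^*).

Definition real_cone (R : realType) (P : nat -> R[i]) : Prop :=
  forall j, 0 <= Re (P j) /\ Im (P j) = 0.

Section Cones.
Variable R : realType.
Implicit Types (x y : R[i]) (P : nat -> R[i]).

Lemma near_ge0_lim (u : nat -> R) (l : R) :
  (\forall n \near \oo, 0 <= u n) -> u @ \oo --> l -> 0 <= l.
Proof.
move=> u0 ul; rewrite -(cvg_lim _ ul) //; apply: limr_ge => //.
by apply/cvg_ex; exists l.
Qed.

(** The form is [p |u|^2 + 2 q Re (u v^* ) + p q |v|^2] for [u = u1 + i u2],
    [v = v1 + i v2]; its discriminant is [4 q (q - p ^+ 2)]. *)
Lemma quad_form_ge0 (p q u1 u2 v1 v2 : R) : 0 <= p -> 0 <= q -> q <= p ^+ 2 ->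
  0 <= p * (u1 ^+ 2 + u2 ^+ 2) + 2 * q * (u1 * v1 + u2 * v2)
       + p * q * (v1 ^+ 2 + v2 ^+ 2).
Proof.
move=> p0 q0 qp.
move: p0; rewrite le_eqVlt => /orP[/eqP p0|p0].
  have -> : q = 0 by apply/le_anti; rewrite q0 (le_trans qp) // -p0 expr0n.
  by rewrite -p0; lra.
rewrite -(pmulr_rge0 _ p0).
have -> : p * (p * (u1 ^+ 2 + u2 ^+ 2) + 2 * q * (u1 * v1 + u2 * v2)
       + p * q * (v1 ^+ 2 + v2 ^+ 2)) =
  (p * u1 + q * v1) ^+ 2 + (p * u2 + q * v2) ^+ 2
  + q * (p ^+ 2 - q) * (v1 ^+ 2 + v2 ^+ 2) by ring.
have q2 : 0 <= q * (p ^+ 2 - q) by rewrite mulr_ge0 // subr_ge0.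
have v0 : 0 <= v1 ^+ 2 + v2 ^+ 2 by rewrite addr_ge0 ?sqr_ge0.
by rewrite !addr_ge0 ?sqr_ge0 // mulr_ge0.
Qed.

(** Take [j = 0], expand bilinearly and write [e_ij] for [Im (P_j (P_i)^* )].
    The first one is a combination of nonnegative terms with coefficients such as
    [p ^+ 2 - q].  In the second one only [q e_04] may be negative.  As
    [e_13 + e_04 = 2 Im x Re (P_0 (P_1)^* )], taking [q e_13] from [p ^+ 2 e_13]
    leaves, together with [p e_03] and [p q e_14], [Im x] times the form of
    [quad_form_ge0] at [P_0], [P_1]. *)
Lemma sector_quad x P p q : 0 < Im x -> (forall j, P j.+3 = x * P j) ->
  sector_cone P -> 0 <= p -> 0 <= q -> q <= p ^+ 2 ->
  sector_cone (fun j => P j + p%:C * P j.+1 + q%:C * P j.+2).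
Proof.
move=> x0 Px KP p0 q0 qp j.
have [h01 h02] := KP j; have [h12 h13] := KP j.+1; have [h23 h24] := KP j.+2.
have sq := subr_ge0 q (p ^+ 2); rewrite qp in sq.
move: h01 h02 h12 h13 h23 h24 => /=.
rewrite [P j.+4]Px [P j.+3]Px.
case: (P j) => a0 b0; case: (P j.+1) => a1 b1; case: (P j.+2) => a2 b2.
case: x x0 Px => X Y /= Y0 _.
set e01 := (X in 0 <= X -> _) => h01.
set e02 := (X in 0 <= X -> _) => h02.
set e12 := (X in 0 <= X -> _) => h12.
set e13 := (X in 0 <= X -> _) => h13.
set e23 := (X in 0 <= X -> _) => h23.
set e24 := (X in 0 <= X -> _) => h24.
have n0 : 0 <= a0 ^+ 2 + b0 ^+ 2 by rewrite addr_ge0 ?sqr_ge0.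
have F := quad_form_ge0 a0 b0 a1 b1 p0 q0 qp.
split.
  rewrite [leRHS](_ : _ = e01 + (p ^+ 2 - q) * e12 + q ^+ 2 * e23 + p * e02
    + p * q * e13 + q * (Y * (a0 ^+ 2 + b0 ^+ 2))).
    clearbody e01 e02 e12 e13 e23 e24.
    by rewrite !addr_ge0 // ?mulr_ge0 ?sqr_ge0 // ?mulr_ge0 ?(ltW Y0) //.
  by rewrite /e01 /e02 /e12 /e13 /e23; ring.
rewrite [leRHS](_ : _ = e02 + p * e12 + p * q * e23 + q ^+ 2 * e24
   + (p ^+ 2 - q) * e13 + Y * (p * (a0 ^+ 2 + b0 ^+ 2) + 2 * q * (a0 * a1 + b0 * b1)
       + p * q * (a1 ^+ 2 + b1 ^+ 2))).
  clearbody e01 e02 e12 e13 e23 e24.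
  apply: addr_ge0; last by rewrite mulr_ge0 // ltW.
  by rewrite !addr_ge0 // ?mulr_ge0 ?sqr_ge0 // ?mulr_ge0 ?(ltW Y0) //.
by rewrite /e02 /e12 /e13 /e23 /e24; ring.
Qed.

(** Strictness comes from the pair [P j.+3 = x * P j], [P j.+1]: if [P j = 0],
    the limit of [n Im (P j.+3 (P j.+1)^* )] is [- Im x |P j.+1|^2]. *)
Lemma sector_section_cone x : 0 < Im x -> section_cone x (@sector_cone R).
Proof.
move=> x0; split.
- move=> Pn P KPn PnP j; split.
    apply: near_ge0_lim (cvgCM (PnP j.+1) (cvgCJ (PnP j))).2.
    by apply: filterS KPn => n /(_ j)[].
  apply: near_ge0_lim (cvgCM (PnP j.+2) (cvgCJ (PnP j))).2.
  by apply: filterS KPn => n /(_ j)[].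
- by move=> P p q Px; exact: (@sector_quad x).
- by move=> P KP j; exact: (KP j.+1).
- move=> P Px P0 P1 P2.
  (* Among three consecutive terms of the sequence at most one is nonzero. *)
  have h j : (P j.+1 * (P j)^* = 0) /\ (P j.+2 * (P j)^* = 0).
    elim: j {-2}j (leqnn j) => [|m ih] j.
      by rewrite leqn0 => /eqP ->; rewrite P1 P2 !mul0r.
    case: j => [|[|[|j]]] jm; rewrite ?P1 ?P2 ?mul0r //.
      by rewrite rmorph0 mulr0.
      by rewrite rmorph0 !mulr0.
    rewrite !Px !rmorphM !(mulrCA _ x^*) -!mulrA.
    have [h1 h2] := ih j (leq_trans (leqnSn _) (ltnW jm)).
    by rewrite h1 h2 !mulr0.
  by move=> j; have [-> ->] := h j.
move=> Pn P j Px KPn PnP PnP'.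
have : 0 <= Im (x * (- P j.+1 * (P j.+1)^*)).
  have C := cvgCMl x (cvgCM PnP' (cvgCJ (PnP j.+1))).
  apply: near_ge0_lim C.2.
  apply: filterS KPn => n /(_ j.+1)[_].
  rewrite Px => h.
  rewrite -!mulrA mulrCA -[n.+1%:R](rmorph_nat (@real_complex_def R (Phant R))).
  by rewrite ImM /= mul0r addr0 mulr_ge0 // mulrA.
case: (P j.+1) => a b; case: x x0 Px => X Y /= Y0 _ h.
have : Y * (a ^+ 2 + b ^+ 2) <= 0 by rewrite -oppr_ge0; apply: le_trans h _; lra.
rewrite pmulr_rle0 // => ab.
have : a ^+ 2 + b ^+ 2 == 0 by rewrite eq_le ab addr_ge0 ?sqr_ge0.
by rewrite paddr_eq0 ?sqr_ge0 // !sqrf_eq0 => /andP[/eqP -> /eqP ->].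
Qed.

Lemma real_section_cone x : Im x = 0 -> 0 < Re x -> section_cone x (@real_cone R).
Proof.
move=> xi xr; split.
- move=> Pn P KPn PnP j; split.
    by apply: near_ge0_lim (PnP j).1; apply: filterS KPn => n /(_ j)[].
  have h := (PnP j).2; apply/le_anti/andP; split.
    rewrite -oppr_ge0; apply: near_ge0_lim (cvgN h).
    by apply: filterS KPn => n /(_ j)[_ /= hn]; rewrite fctE hn oppr0.
  by apply: near_ge0_lim h; apply: filterS KPn => n /(_ j)[_ ->].
- move=> P p q _ KP p0 q0 _ j.
  have [h1 i1] := KP j; have [h2 i2] := KP j.+1; have [h3 i3] := KP j.+2.
  rewrite !ReD !ImD !ReM !ImM i1 i2 i3 /=.
  by rewrite !mulr0 !mul0r !subr0 !addr0 !addr_ge0 // mulr_ge0.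
- by move=> P KP j; exact: (KP j.+1).
- move=> P Px P0 P1 P2 j.
  elim: j {-2}j (leqnn j) => [|m ih] j.
    by rewrite leqn0 => /eqP ->; rewrite P0 /=; split; [lra|lra].
  case: j => [|[|[|j]]] jm; rewrite ?P1 ?P2 ?P0 //=.
    by split; lra.
  have [h1 h2] := ih j (leq_trans (leqnSn _) (ltnW jm)).
  by rewrite Px ReM ImM h2 xi !mulr0 mul0r subr0 addr0 mulr_ge0 // ltW.
move=> Pn P j _ KPn PnP PnP'.
have i0 : Im (P j.+1) = 0.
  have h := (PnP j.+1).2; apply/le_anti/andP; split.
    rewrite -oppr_ge0; apply: near_ge0_lim (cvgN h).
    by apply: filterS KPn => n /(_ j.+1)[_ /= hn]; rewrite fctE hn oppr0.
  by apply: near_ge0_lim h; apply: filterS KPn => n /(_ j.+1)[_ ->].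
have r1 : 0 <= Re (P j.+1).
  by apply: near_ge0_lim (PnP j.+1).1; apply: filterS KPn => n /(_ j.+1)[].
have r2 : 0 <= Re (- P j.+1).
  apply: near_ge0_lim PnP'.1.
  apply: filterS KPn => n /(_ j)[h hi].
  rewrite -[n.+1%:R](rmorph_nat (@real_complex_def R (Phant R))).
  by rewrite ReM hi mulr0 subr0 mulr_ge0.
apply/eqP; rewrite eq_complex i0 eqxx andbT eq_le r1 andbT.
by rewrite -oppr_ge0 -ReN.
Qed.

End Cones.

(** * Multipliers that preserve the cones *)

Definition moment (R : realType) (w v : 'I_3 -> R[i]) (j : nat) : R[i] :=
  \sum_k v k * w k ^+ j.

(** The left sector of the [c] with [|Arg c| >= 2 pi / 3], in a form without
    trigonometry: [|c| <= 2 |Re c|]. *)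
Definition in_sector (R : realType) (c : R[i]) : Prop :=
  Re c < 0 /\ Re c ^+ 2 + Im c ^+ 2 <= 4 * Re c ^+ 2.

Definition conj_symmetric (R : realType) (s : seq R[i]) : Prop :=
  forall c : R[i], count_mem c s = count_mem c^* s.

Lemma conjc_Im0 (R : realType) (c : R[i]) : c^* = c <-> Im c = 0.
Proof.
case: c => a b /=; split=> [[bb]|->]; first lra.
by rewrite oppr0.
Qed.

Lemma Im0_real (R : realType) (c : R[i]) : Im c = 0 -> c = (Re c)%:C.
Proof. by case: c => a b /= ->. Qed.

Section Stability.
Variables (R : realType) (x : R[i]) (w : 'I_3 -> R[i]).
Variable K : (nat -> R[i]) -> Prop.
Hypothesis w3 : forall k, w k ^+ 3 = x.
Hypothesis HK : section_cone x K.
Implicit Types v : 'I_3 -> R[i].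

Lemma moment_period v j : moment w v j.+3 = x * moment w v j.
Proof.
rewrite /moment mulr_sumr; apply: eq_bigr => k _.
by rewrite -(addn3 j) exprD w3 mulrA mulrC.
Qed.

Lemma stable_quad v p q : 0 <= p -> 0 <= q -> q <= p ^+ 2 ->
  K (moment w v) -> K (moment w (fun k => (1 + p%:C * w k + q%:C * w k ^+ 2) * v k)).
Proof.
move=> p0 q0 qp Kv.
rewrite [moment _ _](_ : _ =
    fun j => moment w v j + p%:C * moment w v j.+1 + q%:C * moment w v j.+2).
  by apply: (cone_quad HK) => //; exact: moment_period.
apply/funext => j; rewrite /moment !mulr_sumr -!big_split /=.
by apply: eq_bigr => k _; rewrite !exprS; ring.
Qed.

Lemma stable_X v : K (moment w v) -> K (moment w (fun k => w k * v k)).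
Proof.
move=> Kv; rewrite [moment _ _](_ : _ = fun j => moment w v j.+1).
  exact: (cone_shift HK).
by apply/funext => j; apply: eq_bigr => k _; rewrite exprS; ring.
Qed.

Lemma stable_Xn v m : K (moment w v) -> K (moment w (fun k => w k ^+ m * v k)).
Proof.
move=> Kv; elim: m => [|m ih].
  by rewrite [X in moment w X](_ : _ = v)//; apply/funext => k; rewrite expr0 mul1r.
rewrite [X in moment w X](_ : _ = fun k => w k * (w k ^+ m * v k)); first exact: stable_X.
by apply/funext => k; rewrite exprS mulrA.
Qed.

Lemma cvg_moment (vn : nat -> 'I_3 -> R[i]) v j :
  (forall k, cvgC (fun n => vn n k) (v k)) ->
  cvgC (fun n => moment w (vn n) j) (moment w v j).
Proof.
by move=> vnv; apply: cvgC_sum => k; apply: cvgCM => //; exact: cvgC_cst.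
Qed.

Lemma stable_lim (vn : nat -> 'I_3 -> R[i]) v :
  (\forall n \near \oo, K (moment w (vn n))) ->
  (forall k, cvgC (fun n => vn n k) (v k)) -> K (moment w v).
Proof.
by move=> Kvn vnv; apply: (cone_lim HK Kvn) => j; exact: cvg_moment.
Qed.

(** [expC (s z)] is the limit of powers of the linear factors [1 + (s / n) z]. *)
Lemma stable_exp v s : 0 <= s ->
  K (moment w v) -> K (moment w (fun k => expC (s%:C * w k) * v k)).
Proof.
move=> s0 Kv.
apply: (@stable_lim (fun n k => (1 + s%:C * w k / n.+1%:R) ^+ n.+1 * v k)); last first.
  by move=> k; apply: cvgCM; [exact: expC_euler|exact: cvgC_cst].
apply: nearW => n; elim: {2}n.+1 => [|m ih].
  by rewrite [X in moment w X](_ : _ = v)//; apply/funext => k; rewrite expr0 mul1r.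
have p0 : 0 <= s / n.+1%:R by rewrite divr_ge0.
have := stable_quad p0 (lexx 0) (sqr_ge0 _) ih.
congr (K (moment w _)); apply/funext => k.
rewrite [in RHS]exprS -[RHS]mulrA; congr (_ * _).
by rewrite mul0r addr0 rmorphM fmorphV rmorph_nat mulrAC.
Qed.

Lemma conjc_in_seq (s : seq R[i]) c : conj_symmetric s -> c \in s -> c^* \in s.
Proof. by move=> sym; rewrite -!has_pred1 !has_count sym. Qed.

(** A real zero [c] gives the factor [1 + p z] with [p = - 1 / c]; a nonreal [c] is
    grouped with [c^*], and [(1 - z / c) (1 - z / c^* ) = 1 + p z + q z^2] with
    [p = - 2 Re c / |c|^2] and [q = 1 / |c|^2]. *)
Lemma stable_prod (s : seq R[i]) v :
  (forall c, c \in s -> in_sector c) -> conj_symmetric s ->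
  K (moment w v) -> K (moment w (fun k => (\prod_(c <- s) (1 - w k / c)) * v k)).
Proof.
have [n] := ubnP (size s); elim: n s v => // n ih [|c s] v sn secs sym Kv.
  by rewrite [X in moment w X](_ : _ = v)//; apply/funext => k; rewrite big_nil mul1r.
have [c0 c4] : in_sector c by apply: secs; rewrite mem_head.
have [ci|ci] := eqVneq (Im c) 0.
  have cJ : c^* = c by apply/conjc_Im0.
  have p0 : 0 <= - (Re c)^-1 by rewrite oppr_ge0 invr_le0 ltW.
  rewrite [X in moment w X](_ : _ = fun k => (\prod_(c <- s) (1 - w k / c)) *
     ((1 + (- (Re c)^-1)%:C * w k + 0%:C * w k ^+ 2) * v k)).
    apply: ih.
    - exact: sn.
    - by move=> d ds; apply: secs; rewrite inE ds orbT.
    - move=> d; have := sym d => /=.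
      have -> : (c == d^*) = (c == d) by rewrite -{1}cJ (inj_eq (can_inj (@conjcK _))).
      by move=> /addnI.
    - by apply: stable_quad => //; exact: sqr_ge0.
  apply/funext => k; rewrite big_cons mulrA mul0r addr0 [X in _ = X * _]mulrC.
  congr (_ * _ * _).
  by rewrite {1}(Im0_real ci) rmorphN fmorphV mulNr mulrC.
have cs : c^* \in s.
  have := conjc_in_seq sym (mem_head c s); rewrite inE => /orP[/eqP/conjc_Im0 cc|//].
  by rewrite cc eqxx in ci.
have ss := perm_to_rem cs.
have c2 : 0 < Re c ^+ 2 + Im c ^+ 2.
  by rewrite ltr_wpDr ?sqr_ge0 // exprn_even_gt0 //= lt_eqF.
pose q := (Re c ^+ 2 + Im c ^+ 2)^-1; pose p := - (2 * Re c * q).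
have q0 : 0 < q by rewrite invr_gt0.
have p0 : 0 <= p by rewrite oppr_ge0 mulr_le0_ge0 ?(ltW q0)//; lra.
have qp : q <= p ^+ 2.
  have -> : p ^+ 2 = (4 * Re c ^+ 2) * q ^+ 2 by rewrite /p; ring.
  rewrite -[leLHS]mul1r (expr2 q) mulrA; apply: ler_wpM2r; first exact: ltW.
  by rewrite -ler_pdivrMr // /q invrK mul1r.
rewrite [X in moment w X](_ : _ = fun k => (\prod_(c <- rem c^* s) (1 - w k / c)) *
     ((1 + p%:C * w k + q%:C * w k ^+ 2) * v k)).
  apply: ih.
  - by rewrite size_rem //; exact: leq_ltn_trans (leq_pred _) (sn : (size s < n)%N).
  - by move=> d /mem_rem ds; apply: secs; rewrite inE ds orbT.
  - move=> d; have := sym d => /=; rewrite !(permP ss) /=.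
    have -> : (c^* == d^*) = (c == d) by rewrite (inj_eq (can_inj (@conjcK _))).
    have -> : (c == d^*) = (c^* == d) by rewrite -{1}(conjcK c) (inj_eq (can_inj (@conjcK _))).
    by rewrite [in RHS]addnCA => /addnI/addnI.
  - by apply: stable_quad => //; exact: ltW.
apply/funext => k; rewrite big_cons (perm_big _ ss) /= big_cons.
rewrite [RHS]mulrA [X in _ = X * _]mulrC mulrA; congr (_ * _ * _).
have cn0 : c != 0 by apply/eqP => c00; rewrite c00 ltxx in c0.
have cV : c^-1 = q%:C * c^*.
  apply: (mulfI cn0); rewrite mulfV //.
  rewrite mulrCA.
  have -> : c * c^* = (Re c ^+ 2 + Im c ^+ 2)%:C.
    by case: (c) => a b; apply/eqP; rewrite eq_complex /=; apply/andP; split; apply/eqP; ring.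
  by rewrite -rmorphM /q mulVf ?rmorph1 // gt_eqF.
have cJV : (c^*)^-1 = q%:C * c by rewrite -conjc_inv cV rmorphM /= oppr0 conjcK.
rewrite cV cJV.
have E1 : p%:C = - q%:C * (c + c^*).
  by rewrite addcJ /p rmorphN !rmorphM rmorph_nat; ring.
have E2 : q%:C = q%:C ^+ 2 * (c * c^*).
  by rewrite expr2 -mulrA [X in _ = _ * X]mulrCA -cV mulfV ?mulr1.
rewrite E1 [X in _ = _ + X * _]E2; ring.
Qed.

End Stability.

(** * Power series and multiplicities of zeros *)

Section PowerSeries.
Variable R : realType.
Implicit Types (g c : nat -> R[i]) (z w : R[i]).

Lemma psumC_cvg g z : entire_coef g -> cvgC (pseriesC g z) (psumC g z).
Proof. by move=> /(_ z)/cvgC_limn. Qed.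

Lemma psumCE g z l : cvgC (pseriesC g z) l -> psumC g z = l.
Proof. exact: limn_cvgC. Qed.

Lemma pseriesCE g z n : pseriesC g z n = \sum_(0 <= j < n) g j * z ^+ j.
Proof. by rewrite /pseriesC /series. Qed.

Lemma normc_lim_le (u : nat -> R[i]) l (B : R) :
  (forall n, normc (u n) <= B) -> cvgC u l -> normc l <= B.
Proof.
move=> uB /cvgC_normP ul; rewrite -subr_ge0.
apply: (@near_ge0_lim R (fun n => B - normc l + normc (u n - l))); last first.
  by rewrite -[X in _ --> X]addr0; apply: cvgD => //; exact: cvg_cst.
apply: nearW => n; rewrite addrAC subr_ge0.
have := le_normcD (u n) (l - u n).
rewrite (addrC (u n)) subrK -(normcN (l - u n)) opprB => /le_trans; apply.
by rewrite lerD2r.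
Qed.

Lemma entire_coef_bound g (rho : R) : entire_coef g -> 0 <= rho ->
  exists2 M, 0 <= M & forall j, normc (g j) * rho ^+ j <= M.
Proof.
move=> gE rho0.
have /cvgC_normP gc := psumC_cvg rho%:C gE.
have /cvg_seq_bounded : cvgn (fun n => normc (pseriesC g rho%:C n - psumC g rho%:C)).
  by apply/cvg_ex; exists 0.
move=> [M0 [_ /(_ (M0 + 1))]]; rewrite ltrDl ltr01 => /(_ isT) hM.
set M := M0 + 1 in hM; have {}hM n : normc (pseriesC g rho%:C n - psumC g rho%:C) <= M.
  by rewrite (le_trans _ (hM n I)) //= ler_norm.
have M1 : 0 <= M by rewrite (le_trans _ (hM 0%N)) // normc_ge0.
exists (M + M) => [|j]; first by rewrite addr_ge0.
have -> : normc (g j) * rho ^+ j = normc (g j * rho%:C ^+ j).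
  rewrite ComplexField.Normc.normcM normcX /= expr0n /= addr0 sqrtr_sqr ger0_norm //.
have -> : g j * rho%:C ^+ j = (pseriesC g rho%:C j.+1 - psumC g rho%:C)
   - (pseriesC g rho%:C j - psumC g rho%:C).
  by rewrite !pseriesCE big_nat_recr //=; ring.
by apply: (le_trans (le_normcD _ _)); rewrite normcN lerD.
Qed.

(** Convergence at [4 s], where [s = |w| + 1] bounds both points, gives
    [|g_j| <= M / (4 s)^j]; since [|z^j - w^j| <= j s^(j-1) |z - w|] and
    [j <= 2^j], the terms of the difference are at most [M |z - w| / 2^j]. *)
Lemma psumC_lipschitz g w : entire_coef g ->
  exists L, forall z, normc (z - w) <= 1 ->
    normc (psumC g z - psumC g w) <= L * normc (z - w).
Proof.
move=> gE; pose s := normc w + 1.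
have s1 : 1 <= s by rewrite lerDr normc_ge0.
have s0 : 0 < s by apply: lt_le_trans s1.
have [M M0 hM] := entire_coef_bound gE (mulr_ge0 (ler0n R 4) (ltW s0)).
exists (2 * M) => z zw.
have ws : normc w <= s by rewrite lerDl.
have zs : normc z <= s.
  by rewrite -(subrK w z) (le_trans (le_normcD _ _)) // addrC lerD2l.
apply: (@normc_lim_le (fun n => pseriesC g z n - pseriesC g w n)); last first.
  by apply: cvgCD; [exact: psumC_cvg|apply: cvgCN; exact: psumC_cvg].
move=> n; rewrite !pseriesCE.
have term j : normc (g j * z ^+ j - g j * w ^+ j) <= M * normc (z - w) / 2 ^+ j.
  rewrite -mulrBr ComplexField.Normc.normcM.
  case: j => [|j].
    by rewrite !expr0 subrr ComplexField.Normc.normc0 mulr0 divr1 mulr_ge0 // normc_ge0.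
  apply: (le_trans (ler_wpM2l (normc_ge0 _) (normc_subX j zs ws))).
  rewrite ler_pdivlMr ?exprn_gt0 // mulrA mulrAC ler_wpM2r ?normc_ge0 //.
  apply: le_trans (hM j.+1).
  rewrite -mulrA ler_wpM2l ?normc_ge0 //.
  rewrite exprMn (exprS s) (_ : 4 = 2 * 2 :> R) ?exprMn; last by ring.
  have j2 : j.+1%:R <= 2 ^+ j.+1 :> R.
    by rewrite -natrX ler_nat ltnW // ltn_expl.
  have sj : 0 <= s ^+ j by rewrite exprn_ge0 // ltW.
  have t0 : 0 <= 2 ^+ j.+1 :> R by rewrite exprn_ge0.
  apply: (@le_trans _ _ (2 ^+ j.+1 * s ^+ j * 2 ^+ j.+1)).
    by rewrite ler_wpM2r // ler_wpM2r.
  rewrite [leRHS](_ : _ = s * (2 ^+ j.+1 * s ^+ j * 2 ^+ j.+1)); last by ring.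
  by rewrite ler_peMl // !mulr_ge0.
have geo m : \sum_(0 <= j < m) (M * normc (z - w) / 2 ^+ j)
    = 2 * M * normc (z - w) * (1 - (2 ^+ m)^-1).
  elim: m => [|m ih]; first by rewrite big_nil expr0 invr1 subrr mulr0.
  rewrite big_nat_recr //= ih exprS.
  have : 2 ^+ m != 0 :> R by rewrite expf_neq0.
  by move=> ?; field.
have tot m : normc (\sum_(0 <= j < m) g j * z ^+ j - \sum_(0 <= j < m) g j * w ^+ j)
    <= \sum_(0 <= j < m) (M * normc (z - w) / 2 ^+ j).
  elim: m => [|m ih]; first by rewrite !big_nil subrr ComplexField.Normc.normc0.
  rewrite !big_nat_recr //= opprD addrACA.
  by apply: (le_trans (le_normcD _ _)); rewrite lerD.
apply: (le_trans (tot n)); rewrite geo ler_piMr ?mulr_ge0 ?normc_ge0 //.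
Qed.

Lemma psumC_continuous g (u : nat -> R[i]) w : entire_coef g ->
  (forall n, normc (u n - w) <= 1) -> cvgC u w ->
  cvgC (fun n => psumC g (u n)) (psumC g w).
Proof.
move=> gE u1 /cvgC_normP uw; have [L hL] := psumC_lipschitz w gE.
apply: (@cvgC_dominated _ _ _ (fun n => L * normc (u n - w))).
  by apply: nearW => n; exact: hL.
by rewrite -(mulr0 L); apply: cvgM => //; exact: cvg_cst.
Qed.

(** For [m < n], dividing by [(z - w)^m] off [w] shows that one quotient is a
    positive power of [z - w] times the other, hence vanishes at [w] by
    continuity. *)
Lemma zero_multiplicity_inj c w m n :
  zero_multiplicity c w m -> zero_multiplicity c w n -> m = n.
Proof.
wlog mn : m n / (m <= n)%N.
  move=> H hm hn; have [/H|/ltnW/H] := leqP m n; first exact.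
  by move=> -> .
move=> [g [gE gw cg]] [h [hE hw ch]].
move: mn; rewrite leq_eqVlt => /orP[/eqP//|mn].
pose u (k : nat) : R[i] := w + (k.+1%:R^-1)%:C.
have uwE k : u k - w = (k.+1%:R^-1)%:C by rewrite /u; ring.
have nu k : normc (u k - w) = k.+1%:R^-1.
  by rewrite uwE /= expr0n /= addr0 sqrtr_sqr ger0_norm.
have u1 k : normc (u k - w) <= 1 by rewrite nu invf_le1 // ler1n.
have uw : cvgC u w.
  by apply/cvgC_normP; under eq_fun do rewrite nu; exact: cvg_harmonic.
have uw0 k : u k - w != 0.
  by rewrite uwE eq_complex /= eqxx andbT invr_eq0 pnatr_eq0.
have gh k : psumC g (u k) = (u k - w) ^+ (n - m) * psumC h (u k).
  apply: (mulfI (_ : (u k - w) ^+ m != 0)); first by rewrite expf_neq0.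
  by rewrite mulrA -exprD subnKC ?(ltnW mn) // -cg -ch.
case/eqP: gw.
apply: (cvgC_unique (psumC_continuous gE u1 uw)).
under eq_fun do rewrite gh.
have : cvgC (fun k => (u k - w) ^+ (n - m) * psumC h (u k)) ((w - w) ^+ (n - m) * psumC h w).
  apply: cvgCM; last exact: psumC_continuous.
  by apply: cvgCX; apply: cvgCD => //; exact: cvgC_cst.
by rewrite subrr expr0n subn_eq0 leqNgt mn mul0r.
Qed.

Lemma pseriesCJ g z n : pseriesC (fun j => (g j)^*) z^* n = (pseriesC g z n)^*.
Proof.
rewrite !pseriesCE rmorph_sum /=; apply: eq_bigr => j _.
by rewrite rmorphM rmorphXn.
Qed.

Lemma cvg_pseriesCJ g z : entire_coef g ->
  cvgC (pseriesC (fun j => (g j)^*) z^*) (psumC g z)^*.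
Proof.
move=> gE; have := cvgCJ (psumC_cvg z gE).
by under eq_fun do rewrite -pseriesCJ.
Qed.

Lemma psumCJ g z : entire_coef g -> psumC (fun j => (g j)^*) z^* = (psumC g z)^*.
Proof. by move=> gE; apply: psumCE; exact: cvg_pseriesCJ. Qed.

Lemma entire_coefJ g : entire_coef g -> entire_coef (fun j => (g j)^*).
Proof.
move=> gE z; have := cvg_pseriesCJ z^* gE; rewrite conjcK => /cvgCP h.
by apply/cvg_ex; eexists; exact: h.
Qed.

Lemma realcoefJ (a : nat -> R) : (fun j => (realcoef a j)^*) = realcoef a.
Proof. by apply/funext => j; rewrite /realcoef conjc_real. Qed.

Lemma psumC_realcoefJ (a : nat -> R) z : entire_coef (realcoef a) ->
  psumC (realcoef a) z^* = (psumC (realcoef a) z)^*.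
Proof. by move=> aE; rewrite -psumCJ // realcoefJ. Qed.

Lemma zero_multiplicityJ (a : nat -> R) w m : entire_coef (realcoef a) ->
  zero_multiplicity (realcoef a) w m -> zero_multiplicity (realcoef a) w^* m.
Proof.
move=> aE [g [gE gw ag]]; exists (fun j => (g j)^*); split.
- exact: entire_coefJ.
- by rewrite psumCJ // conjc_eq0.
move=> z; rewrite -[z]conjcK psumC_realcoefJ // psumCJ // ag.
by rewrite rmorphM rmorphXn rmorphB.
Qed.

End PowerSeries.

(** * Conjugate-symmetric partial products *)

Section Tails.
Variable R : realType.
Implicit Types (u : nat -> R[i]).

Lemma normc_sum_le (I : Type) (s : seq I) (u : I -> R[i]) :
  normc (\sum_(i <- s) u i) <= \sum_(i <- s) normc (u i).
Proof.
elim: s => [|i s ih]; first by rewrite !big_nil ComplexField.Normc.normc0.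
by rewrite !big_cons (le_trans (le_normcD _ _)) // lerD2l.
Qed.

(** Expanding both sides, the right one majorizes the left one term by term. *)
Lemma normc_prod_sub1_le (I : Type) (s : seq I) (u : I -> R[i]) :
  normc (\prod_(i <- s) (1 - u i) - 1) <= expR (\sum_(i <- s) normc (u i)) - 1.
Proof.
elim: s => [|i s ih].
  by rewrite !big_nil subrr ComplexField.Normc.normc0 expR0 subrr.
rewrite !big_cons expRD; set Q := \prod_(i <- s) _ in ih *.
set E := expR (\sum_(i <- s) _) in ih *.
have QE : normc Q <= E.
  rewrite -(subrK 1 Q) (le_trans (le_normcD _ _)) // ComplexField.Normc.normc1.
  by rewrite -lerBrDr.
have -> : (1 - u i) * Q - 1 = (Q - 1) - u i * Q by ring.
apply: (le_trans (le_normcD _ _)); rewrite normcN ComplexField.Normc.normcM.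
have h1 : normc (u i) * normc Q <= normc (u i) * E by rewrite ler_wpM2l // normc_ge0.
have E0 : 0 <= E := expR_ge0 _.
have h2 : (1 + normc (u i)) * E <= expR (normc (u i)) * E.
  by rewrite ler_wpM2r // expR_ge1Dx.
lra.
Qed.

Lemma prod_primary_factor (s : seq R[i]) (z : R[i]) :
  \prod_(c <- s) primary_factor c z =
  (\prod_(c <- s) (1 - z / c)) * expC (z * \sum_(c <- s) c^-1).
Proof.
elim: s => [|c s ih]; first by rewrite !big_nil mulr0 expC0 mulr1.
by rewrite !big_cons ih /primary_factor mulrDr expCD; ring.
Qed.

Variables (N : option nat) (zs : nat -> R[i]).
Hypothesis sum_abs_cvg : cvgn (list_sum N (fun j => `|zs j|^-1)).

Let inv_norm_sum n := \sum_(0 <= j < n | in_list N j) (normc (zs j))^-1.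

Lemma list_sum_normE n : list_sum N (fun j => `|zs j|^-1) n = (inv_norm_sum n)%:C.
Proof.
rewrite /list_sum /inv_norm_sum rmorph_sum; apply: eq_bigr => j _.
by rewrite norm_normcE -fmorphV.
Qed.

Variables (M : nat -> nat) (P : nat -> pred nat).
Hypothesis PN : forall n j, P n j -> in_list N j.
Let tail n := [seq j <- iota n (M n) | P n j].

(** The tail sum is at most the limit of the whole series minus its [n]-th partial
    sum. *)
Lemma tail_norm_cvg0 :
  (fun n => \sum_(j <- tail n) (normc (zs j))^-1) @ \oo --> 0.
Proof.
have [h _] := cvgC_limn sum_abs_cvg.
have {}h : inv_norm_sum @ \oo --> Re (limn (list_sum N (fun j => `|zs j|^-1))).
  by move: h; under eq_fun do rewrite list_sum_normE.
have nd : nondecreasing_seq inv_norm_sum.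
  apply/nondecreasing_seqP => n; rewrite /inv_norm_sum big_mkcond /=.
  rewrite [leRHS]big_mkcond /= big_nat_recr //= lerDl.
  by case: ifP => // _; rewrite invr_ge0 normc_ge0.
set L := Re _ in h.
have sL n : inv_norm_sum n <= L.
  rewrite -(cvg_lim _ h) //; apply: nondecreasing_cvgn_le => //.
  by apply/cvg_ex; exists L.
apply: (@squeeze_cvgr _ _ _ _ (fun=> 0) (fun n => L - inv_norm_sum n)).
- apply: nearW => n; apply/andP; split.
    by apply: sumr_ge0 => j _; rewrite invr_ge0 normc_ge0.
  rewrite lerBrDl (le_trans _ (sL (n + M n)%N)) //.
  rewrite /inv_norm_sum /index_iota !subn0 iotaD big_cat /= lerD2l.
  rewrite add0n big_filter big_mkcond [leRHS]big_mkcond /=.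
  apply: ler_sum => j _; case: ifP => [/PN -> //|_].
  by case: ifP => // _; rewrite invr_ge0 normc_ge0.
- exact: cvg_cst.
- by rewrite -(subrr L); apply: cvgB => //; exact: cvg_cst.
Qed.

Lemma tail_sum_cvg0 : cvgC (fun n => \sum_(c <- map zs (tail n)) c^-1) 0.
Proof.
apply: cvgC_dominated tail_norm_cvg0.
apply: nearW => n; rewrite subr0 big_map (le_trans (normc_sum_le _ _)) //.
by apply: ler_sum => j _; rewrite ComplexField.Normc.normcV.
Qed.

Lemma tail_prod_cvg1 z :
  cvgC (fun n => \prod_(c <- map zs (tail n)) primary_factor c z) 1.
Proof.
under eq_fun do rewrite prod_primary_factor.
rewrite -[X in cvgC _ X]mulr1; apply: cvgCM; last first.
  by have := expC_cvg (cvgCMl z tail_sum_cvg0); rewrite mulr0 expC0.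
apply: (@cvgC_dominated _ _ _
  (fun n => expR (normc z * \sum_(j <- tail n) (normc (zs j))^-1) - 1)).
  apply: nearW => n; rewrite big_map (le_trans (normc_prod_sub1_le _ _)) //.
  rewrite lerD2r ler_expR mulr_sumr le_eqVlt; apply/orP; left; apply/eqP.
  by apply: eq_bigr => j _; rewrite ComplexField.Normc.normcM ComplexField.Normc.normcV.
have h : (fun n => normc z * \sum_(j <- tail n) (normc (zs j))^-1) @ \oo --> 0.
  rewrite -[X in _ --> X](mulr0 (normc z)); apply: cvgM => //.
    exact: cvg_cst.
  exact: tail_norm_cvg0.
have e1 := continuous_cvg _ (@continuous_expR R _) h.
have := cvgB (e1 _) (cvg_cst (1 : R)); rewrite expR0 subrr; exact.
Qed.

End Tails.

Section ConjugateClosure.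
Local Open Scope card_scope.
Variables (R : realType) (a : nat -> R) (N : option nat) (zs : nat -> R[i]).
Hypothesis f_entire : entire_coef (realcoef a).
Hypothesis zs_zeros : lists_nonzero_zeros (realcoef a) N zs.

Lemma size_card_eq (T : choiceType) (s : seq T) m :
  uniq s -> [set` s] #= `I_m -> size s = m.
Proof.
move=> us sm; rewrite -(card_fset_set sm); apply: perm_size.
apply: uniq_perm => [//||x]; first by case: (fset_set _).
rewrite in_fset_set; last by apply/finite_seqP; exists s.
by apply/idP/idP => [xs|/set_mem//]; apply/mem_set.
Qed.

Lemma count_list_zeros (c : R[i]) m n :
  [set j | in_list N j /\ zs j = c] #= `I_m ->
  (forall j, in_list N j -> zs j = c -> (j < n)%N) ->
  count (fun j => in_list N j && (zs j == c)) (iota 0 n) = m.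
Proof.
move=> cm cn; rewrite -size_filter; apply: size_card_eq.
  by rewrite filter_uniq // iota_uniq.
rewrite (_ : [set` _] = [set j | in_list N j /\ zs j = c]) //.
apply/seteqP; split=> j /=; rewrite mem_filter mem_iota add0n.
  by case/andP=> /andP[? /eqP].
by case=> jN jc; rewrite jN jc eqxx /= (cn j).
Qed.

Lemma zeros_bounded (s : seq R[i]) : (forall c, c \in s -> c != 0) ->
  exists n, forall j, in_list N j -> zs j \in s -> (j < n)%N.
Proof.
elim: s => [|c s ih] s0; first by exists 0%N.
have [n hn] := ih (fun d ds => s0 d (mem_behead (ds : d \in behead (c :: s)))).
have [m _ cm] := zs_zeros.2 c (s0 c (mem_head _ _)).
have : finite_set [set j | in_list N j /\ zs j = c] by exists m.
move=> /finite_seqP[t ht]; exists (maxn n (\max_(j <- t) j.+1)) => j jN.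
rewrite inE leq_max => /orP[/eqP jc|js]; last by rewrite (hn j jN js).
have jt : j \in t by have : [set` t] j by rewrite -ht.
by apply/orP; right; exact: (@leq_bigmax_seq _ t xpredT (fun i => i.+1) j jt).
Qed.

(** The partial products in the given order need not be real.  Let [s] be the
    values of the first [n] zeros and their conjugates.  Keeping every index whose
    zero is in [s] gives each [c] in [s] its full multiplicity, which is the same
    for [c] and [c^*] as [f] is real. *)
Lemma conjugate_completion n : exists M, exists P : pred nat,
  (forall j, P j -> in_list N j) /\
  conj_symmetric (map zs ([seq j <- iota 0 n | in_list N j] ++
                          [seq j <- iota n M | P j])).
Proof.
pose s0 := map zs [seq j <- iota 0 n | in_list N j].
pose s := s0 ++ map conjc s0.
have s_neq0 c : c \in s -> c != 0.
  have h d : d \in s0 -> d != 0.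
    by case/mapP => j; rewrite mem_filter => /andP[jN _] ->; exact: zs_zeros.1.
  by rewrite mem_cat => /orP[/h//|/mapP[d /h d0 ->]]; rewrite conjc_eq0.
have sJ c : (c^* \in s) = (c \in s).
  have J d : (d^* \in map conjc s0) = (d \in s0).
    by rewrite mem_map //; exact: can_inj (@conjcK _).
  by rewrite !mem_cat J -(J c^*) conjcK orbC.
have [T hT] := zeros_bounded s_neq0.
exists (T - n)%N, (fun j => in_list N j && (zs j \in s)); split.
  by move=> j /andP[].
set l := _ ++ _.
have -> : l = [seq j <- iota 0 (maxn n T) | in_list N j && (zs j \in s)].
  rewrite maxnE iotaD filter_cat /l add0n; congr (_ ++ _).
  apply: eq_in_filter => j jn; have [jN|//] := boolP (in_list N j).
  by rewrite mem_cat map_f // mem_filter jN.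
move=> c; rewrite !count_map !count_filter.
have E d : count (predI (preim zs (pred1 d)) (fun j => in_list N j && (zs j \in s)))
    (iota 0 (maxn n T))
   = if d \in s then count (fun j => in_list N j && (zs j == d)) (iota 0 (maxn n T)) else 0%N.
  case: ifP => ds.
    apply: eq_count => j /=; case: eqP => [->|_]; rewrite ?ds ?andbT ?andbF //.
  apply: (etrans _ (count_pred0 (iota 0 (maxn n T)))); apply: eq_count => j /=.
  by case: eqP => [->|//]; rewrite ds andbF.
rewrite !E sJ; case: ifP => // cs.
have cJs : c^* \in s by rewrite sJ.
have [m mc cm] := zs_zeros.2 c (s_neq0 c cs).
have [m' mc' cm'] := zs_zeros.2 c^* (s_neq0 _ cJs).
rewrite (count_list_zeros cm); last first.
  by move=> j jN jc; rewrite leq_max (hT j jN) ?orbT // jc.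
rewrite (count_list_zeros cm'); last first.
  by move=> j jN jc; rewrite leq_max (hT j jN) ?orbT // jc.
exact: zero_multiplicity_inj (zero_multiplicityJ f_entire mc) mc'.
Qed.

End ConjugateClosure.

(** * Zeros of the sections *)

Section Sector.
Variable R : realType.

(** [cos t] is a root of [4 c^3 - 3 c - 1 = (c - 1) (2 c + 1)^2] because
    [cos (3 t) = 1], and it is not 1. *)
Lemma cos_2pi3 : cos (2 * pi / 3) = - (1 / 2) :> R.
Proof.
have p0 := @pi_gt0 R.
pose t : R := 2 * pi / 3; rewrite -/t.
have c1 : cos t < 1.
  rewrite -cos0 ltr_cos ?in_itv /= /t; first by rewrite divr_gt0 // mulr_gt0.
    by apply/andP; split; lra.
  by apply/andP; split; lra.
have := cos2pi R; rewrite (_ : pi *+ 2 = t + t + t); last by rewrite /t mulr2n; field.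
rewrite !cosD !sinD => h.
have cs := cos2Dsin2 t.
have : (cos t - 1) * (2 * cos t + 1) ^+ 2 = 0.
  rewrite [LHS](_ : _ = ((cos t * cos t - sin t * sin t) * cos t
    - (sin t * cos t + cos t * sin t) * sin t - 1)
    + 3 * cos t * (cos t ^+ 2 + sin t ^+ 2 - 1)); last by ring.
  by rewrite cs h !subrr mulr0 addr0.
move/eqP; rewrite mulf_eq0 subr_eq0 lt_eqF //= sqrf_eq0 => /eqP; lra.
Qed.

Lemma Arg_in_sector (c : R[i]) : c != 0 -> 2 * pi / 3 < `|Arg c| -> in_sector c.
Proof.
move=> c0; have p0 := @pi_gt0 R.
have n0 : 0 < normc c.
  rewrite lt_def normc_ge0 andbT; apply: contra c0 => /eqP/ComplexField.Normc.eq0_normc ->.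
  by [].
pose t := Re c / normc c.
have tn : `|t| <= 1.
  by rewrite normrM normfV (ger0_norm (ltW n0)) ler_pdivrMr // mul1r ger_normRe.
have t1 : -1 <= t <= 1 by rewrite -ler_norml.
have a0 := acos_ge0 t1; have ap := acos_lepi t1.
have -> : `|Arg c| = acos t.
  by rewrite /Arg -/t; case: ifP => _; rewrite ?normrN ger0_norm.
rewrite -ltr_cos ?in_itv /=; last 2 first.
- by apply/andP; split; lra.
- by rewrite a0 ap.
rewrite acosK ?in_itv //= cos_2pi3 ltr_pdivrMr // => h.
have Rc : Re c < 0 by lra.
split => //.
have -> : Re c ^+ 2 + Im c ^+ 2 = normc c ^+ 2.
  by case: (c) => x y /=; rewrite sqr_sqrtr // addr_ge0 ?sqr_ge0.
have -> : 4 * Re c ^+ 2 = (- 2 * Re c) ^+ 2 by ring.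
by rewrite ler_sqr ?nnegrE; lra.
Qed.

End Sector.

Section Zeros.
Local Open Scope card_scope.
Variables (R : realType) (a : nat -> R) (p : nat) (B : R) (C : R[i])
    (N : option nat) (zs : nat -> R[i]).
Hypotheses (f_entire : entire_coef (realcoef a))
    (zs_zeros : lists_nonzero_zeros (realcoef a) N zs)
    (prod_cvg : forall z : R[i],
       cvgn (list_prod N (fun j => primary_factor (zs j) z)))
    (factorization : forall z : R[i],
       psumC (realcoef a) z =
         z ^+ p * expC (B%:C * z + C)
         * limn (list_prod N (fun j => primary_factor (zs j) z)))
    (zs_sector : forall j, in_list N j -> in_sector (zs j))
    (sum_abs_cvg : cvgn (list_sum N (fun j => `|zs j|^-1)))
    (sum_pos : 0 < B + Re (limn (list_sum N (fun j => (zs j)^-1)))).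

Let f := psumC (realcoef a).

Lemma zero_in_sector (c : R[i]) : c != 0 -> f c = 0 -> in_sector c.
Proof.
move=> c0 fc; have [m [g [gE gc fg]] cm] := zs_zeros.2 c c0.
have m0 : m != 0%N.
  by apply: contraNneq gc => m0; rewrite -[psumC g c]mul1r -(expr0 (c - c)) -m0 -fg -/f fc.
have [[j [jN jc]]|s0] := pselect (exists j, in_list N j /\ zs j = c).
  by rewrite -jc; exact: zs_sector.
case/negP: m0; apply/eqP/esym/card_eq_II.
rewrite II0; apply: card_eq_trans cm; rewrite card_eq_sym card_eq0; apply/eqP.
by apply/seteqP; split=> // j /= hj; apply: s0; exists j.
Qed.

(** The limit in the hypothesis on [B] is an actual limit: both components converge
    absolutely. *)
Lemma list_sum_inv_cvg :
  cvgC (list_sum N (fun j => (zs j)^-1)) (limn (list_sum N (fun j => (zs j)^-1))).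
Proof.
apply: cvgC_limn.
pose b j := if in_list N j then (normc (zs j))^-1 else 0.
have b0 j : 0 <= b j by rewrite /b; case: ifP => // _; rewrite invr_ge0 normc_ge0.
have bc : cvgn (series b).
  have [h _] := cvgC_limn sum_abs_cvg.
  apply/cvg_ex; exists (Re (limn (list_sum N (fun j => `|zs j|^-1)))).
  rewrite (_ : series b = fun n => Re (list_sum N (fun j => `|zs j|^-1) n)) //.
  by apply/funext => n; rewrite list_sum_normE /= big_mkcond.
have comp (u : R[i] -> R) : (forall x, `|u x| <= normc x) -> u 0 = 0 ->
    {morph u : x y / x + y} ->
    cvgn (fun n => u (list_sum N (fun j => (zs j)^-1) n)).
  move=> un u0 uD.
  have -> : (fun n => u (list_sum N (fun j => (zs j)^-1) n)) =
     series (fun j => if in_list N j then u (zs j)^-1 else 0).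
    apply/funext => n; rewrite /list_sum big_mkcond /series /= (big_morph u uD u0).
    by apply: eq_bigr => j _; case: ifP.
  apply: (@normed_cvg R R^o).
  apply: (series_le_cvg _ b0 _ bc) => j; first exact: normr_ge0.
  rewrite /= /b; case: ifP => _; last by rewrite -[X in X <= _]/`|0 : R| normr0.
  by apply: le_trans (un _) _; rewrite ComplexField.Normc.normcV.
have /cvg_ex[l1 h1] := comp Re (@ger_normRe R) erefl (@ReD R).
have /cvg_ex[l2 h2] := comp Im (@ger_normIm R) erefl (@ImD R).
apply/cvg_ex; exists (l1 +i* l2); apply/cvgCP; split; [exact: h1|exact: h2].
Qed.

Lemma conj_symmetric_sumV (s : seq R[i]) : conj_symmetric s ->
  Im (\sum_(c <- s) c^-1) = 0.
Proof.
move=> sym; apply/conjc_Im0.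
have ps : perm_eq s (map conjc s).
  apply/allP => c _ /=; rewrite count_map sym; apply/eqP/eq_count => d /=.
  by rewrite -{1}(conjcK d) (inj_eq (can_inj (@conjcK _))).
rewrite [in RHS](perm_big _ ps) /= big_map rmorph_sum /=.
by apply: eq_bigr => c _; rewrite conjc_inv.
Qed.

Let beta := B + Re (limn (list_sum N (fun j => (zs j)^-1))).

(** At stage [n], collecting the exponential parts of the primary factors gives
    [expC ((s + B + sigma n) z)] times a polynomial whose zeros are symmetric, where
    [sigma n] is the sum of the inverses of these zeros.  It is real, and
    [s + B + sigma n] tends to [s + beta > 0], so it is positive for large [n].
    The factor [expC (- C)] removes a constant that would rotate the moments. *)
Lemma factorized_stable (x : R[i]) (w : 'I_3 -> R[i]) (K : (nat -> R[i]) -> Prop) (s : R) :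
  section_cone x K -> (forall k, w k ^+ 3 = x) ->
  K (moment w (fun=> 1)) -> - beta < s ->
  K (moment w (fun k => expC (s%:C * w k) * (f (w k) * expC (- C)))).
Proof.
move=> HK w3 K1 sbeta.
have [M hM] := choice (conjugate_completion f_entire zs_zeros).
have [P hP] := choice hM.
have PN n j : P n j -> in_list N j by exact: (hP n).1.
pose S n := map zs ([seq j <- iota 0 n | in_list N j] ++ [seq j <- iota n (M n) | P n j]).
have symS n : conj_symmetric (S n) := (hP n).2.
have secS n c : c \in S n -> in_sector c.
  case/mapP => j; rewrite mem_cat !mem_filter => /orP[]/andP[jN _] ->.
    exact: zs_sector.
  by apply: zs_sector; exact: PN jN.
pose sigma n := Re (\sum_(c <- S n) c^-1).
have sigmaE n : \sum_(c <- S n) c^-1 = (sigma n)%:C.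
  exact/Im0_real/conj_symmetric_sumV.
have sigma_cvg : sigma @ \oo --> Re (limn (list_sum N (fun j => (zs j)^-1))).
  have := (cvgCD list_sum_inv_cvg (tail_sum_cvg0 sum_abs_cvg M PN)).1.
  rewrite addr0 => h; rewrite (_ : sigma = fun n => Re (list_sum N (fun j => (zs j)^-1) n +
    \sum_(c <- map zs [seq j <- iota n (M n) | P n j]) c^-1)) //.
  apply/funext => n; rewrite /sigma /S map_cat big_cat /= [X in X + _]big_map big_filter.
  by rewrite /list_sum /index_iota subn0.
pose vn n k := expC ((s + B)%:C * w k) * (w k ^+ p * \prod_(c <- S n) primary_factor c (w k)).
apply: (stable_lim HK (vn := vn)); last first.
  move=> k; rewrite /vn /f factorization.
  pose L : R[i] := limn (list_prod N (fun j => primary_factor (zs j) (w k))).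
  rewrite -/L.
  have -> : expC (s%:C * w k) * (w k ^+ p * expC (B%:C * w k + C) * L * expC (- C)) =
     expC ((s + B)%:C * w k) * (w k ^+ p * (L * 1)).
    rewrite expCD rmorphD mulrDl expCD.
    have eC : expC C * expC (- C) = 1 by rewrite -expCD subrr expC0.
    transitivity (expC (s%:C * w k) * w k ^+ p * expC (B%:C * w k) * L
      * (expC C * expC (- C))).
      by ring.
    by rewrite eC; ring.
  apply: cvgCMl; apply: cvgCMl.
  have := cvgCM (cvgC_limn (@prod_cvg (w k))) (tail_prod_cvg1 sum_abs_cvg M PN (w k)).
  congr cvgC; apply/funext => n.
  rewrite /S map_cat big_cat /= [in RHS]big_map big_filter.
  by rewrite /list_prod /index_iota subn0.
have bpos : 0 < s + beta by rewrite -ltrBlDr sub0r.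
have near_pos : \forall n \near \oo, 0 < s + (B + sigma n).
  have : (fun n => s + (B + sigma n)) @ \oo --> s + beta.
    by apply: cvgD; [exact: cvg_cst|apply: cvgD => //; exact: cvg_cst].
  by move=> /cvgr_gt h; exact: (h _ bpos).
apply: filterS near_pos => n npos.
rewrite [X in moment w X](_ : _ = fun k => expC ((s + (B + sigma n))%:C * w k) *
   (w k ^+ p * ((\prod_(c <- S n) (1 - w k / c)) * 1))).
  apply: (stable_exp w3 HK (ltW npos)); apply: (stable_Xn HK).
  exact: (stable_prod w3 HK (@secS n) (symS n) K1).
apply/funext => k; rewrite /vn prod_primary_factor sigmaE.
have -> : (s + (B + sigma n))%:C * w k = (s + B)%:C * w k + w k * (sigma n)%:C.
  by rewrite !rmorphD /=; ring.
by rewrite [in RHS]expCD; ring.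
Qed.

Section Nodes.
Variables (om z : R[i]).
Hypothesis om2 : 1 + om + om ^+ 2 = 0.
Hypothesis z0 : z != 0.

Let w (k : 'I_3) := z * om ^+ k.

Lemma om3 : om ^+ 3 = 1.
Proof.
apply/eqP; rewrite -subr_eq0; apply/eqP.
transitivity ((om - 1) * (1 + om + om ^+ 2)); first ring.
by rewrite om2 mulr0.
Qed.

Lemma node3 k : w k ^+ 3 = z ^+ 3.
Proof. by rewrite exprMn exprAC om3 expr1n mulr1. Qed.

Lemma sum_node_pow i : \sum_k w k ^+ i = z ^+ i * (if (3 %| i)%N then 3 else 0).
Proof.
under eq_bigr do rewrite exprMn exprAC.
rewrite -mulr_sumr; congr (_ * _).
rewrite !big_ord_recl big_ord0 /= /bump /= addr0 expr0 expr1 addrA.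
have -> : om ^+ i = om ^+ (i %% 3).
  by rewrite {1}(divn_eq i 3) exprD mulnC exprM om3 expr1n mul1r.
rewrite /dvdn; have := ltn_pmod i (isT : 0 < 3)%N.
case: (i %% 3)%N => [|[|[|]]]//= _; first by rewrite expr0 expr1n; ring.
by rewrite -exprM (exprD om 3 1) om3 mul1r addrAC.
Qed.

(** Lagrange interpolation at the nodes: [X^2 + X w_k + w_k^2] vanishes at the two
    nodes other than [w_k]. *)
Lemma moments_eq0 (v : 'I_3 -> R[i]) i :
  moment w v i = 0 -> moment w v i.+1 = 0 -> moment w v i.+2 = 0 -> forall k, v k = 0.
Proof.
have om0 : om != 0.
  by apply: contra_eq_neq om2 => ->; rewrite expr0n /= !addr0 oner_neq0.
have zi0 : z ^+ i != 0 by rewrite expf_neq0.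
move=> P0 P1 P2 k.
have wk0 : w k ^+ i != 0 by rewrite expf_neq0 // mulf_neq0 // expf_neq0.
have H : \sum_l (v l * w l ^+ i) * (w l ^+ 2 + w l * w k + w k ^+ 2) = 0.
  transitivity (moment w v i.+2 + w k * moment w v i.+1 + w k ^+ 2 * moment w v i).
    rewrite /moment !mulr_sumr -!big_split /=; apply: eq_bigr => l _.
    by rewrite !exprS; ring.
  by rewrite P0 P1 P2 !mulr0 !addr0.
have D l : l != k -> w l ^+ 2 + w l * w k + w k ^+ 2 = 0.
  move=> lk; rewrite /w !exprMn.
  have -> : z ^+ 2 * (om ^+ l) ^+ 2 + z * om ^+ l * (z * om ^+ k) + z ^+ 2 * (om ^+ k) ^+ 2 =
    z ^+ 2 * ((om ^+ l) ^+ 2 + om ^+ l * om ^+ k + (om ^+ k) ^+ 2) by ring.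
  have om4 : om ^+ 4 = om by rewrite (exprD om 3 1) om3 mul1r.
  have E1 : 1 + om + om ^+ 2 = 0 := om2.
  suff -> : (om ^+ l) ^+ 2 + om ^+ l * om ^+ k + (om ^+ k) ^+ 2 = 0 by rewrite mulr0.
  case: k lk {H wk0} => [[|[|[|]]]] // ?; case: l => [[|[|[|]]]] //= ? _;
    rewrite -?exprM -?exprD /= ?expr1 ?expr0 ?om4 ?om3 -?om2; ring.
move: H; rewrite (bigD1 k) //= big1 ?addr0 => [|l lk]; last by rewrite D ?mulr0.
move/eqP; rewrite !mulf_eq0 (negPf wk0) orbF => /orP[/eqP//|].
have -> : w k ^+ 2 + w k * w k + w k ^+ 2 = 3 * w k ^+ 2 by ring.
by rewrite mulf_eq0 pnatr_eq0 /= expf_eq0 /= mulf_eq0 (negPf z0) expf_eq0 (negPf om0) andbF.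
Qed.

(** One vanishing moment propagates to all the following ones, hence to all values
    [f (w k)], and the three nodes would be zeros of [f] with negative real parts
    and sum 0. *)
Lemma moment_nonzero (K : (nat -> R[i]) -> Prop) j :
  section_cone (z ^+ 3) K -> moment w (fun k => f (w k)) j <> 0.
Proof.
move=> HK.
pose v k := f (w k) * expC (- C).
have mv i : moment w v i = expC (- C) * moment w (fun k => f (w k)) i.
  by rewrite /moment mulr_sumr; apply: eq_bigr => k _; rewrite /v; ring.
move=> fj; have {fj}vj : moment w v j = 0 by rewrite mv fj mulr0.
have K1 : K (moment w (fun=> 1)).
  have m i : moment w (fun=> 1) i = z ^+ i * (if (3 %| i)%N then 3 else 0).
    by rewrite -sum_node_pow; apply: eq_bigr => k _; rewrite mul1r.
  apply: (cone_one HK).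
  - by move=> i; exact: moment_period node3 _ _.
  - by rewrite m expr0 mul1r.
  - by rewrite m mulr0.
  - by rewrite m mulr0.
pose vn n k := expC ((- n.+1%:R^-1)%:C * w k) * v k.
have Kvn : \forall n \near \oo, K (moment w (vn n)).
  have h := @cvg_harmonic R.
  have : \forall n \near \oo, harmonic n < beta by move/cvgr_lt: h => h; exact: (h _ sum_pos).
  apply: filterS => n /= hn.
  by apply: (factorized_stable HK node3 K1); rewrite ltrN2.
have vnv k : cvgC (fun n => vn n k) (v k).
  rewrite -[X in cvgC _ X]mul1r; apply: cvgCM; last exact: cvgC_cst.
  rewrite -expC0 -(mul0r (w k)); apply: expC_cvg; apply: cvgCM; last exact: cvgC_cst.
  split => /=; last exact: cvg_cst.
  by rewrite -[X in _ --> X]oppr0; apply: cvgN; exact: cvg_harmonic.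
have step i : moment w v i = 0 -> moment w v i.+1 = 0.
  move=> vi.
  apply: (@cone_strict _ _ _ HK (fun n => moment w (vn n)) (moment w v) i) => //.
  - by move=> n l; exact: moment_period node3 _ _.
  - by move=> l; exact: cvg_moment.
  have -> : - moment w v i.+1 = \sum_k (- w k) * (v k * w k ^+ i).
    by rewrite /moment -sumrN; apply: eq_bigr => k _; rewrite exprS; ring.
  have -> : (fun n => n.+1%:R * moment w (vn n) i) =
    fun n => \sum_k (n.+1%:R * (expC (- w k / n.+1%:R) - 1)) * (v k * w k ^+ i).
    apply/funext => n.
    have -> : moment w (vn n) i = moment w (vn n) i - moment w v i by rewrite vi subr0.
    rewrite /moment -sumrB mulr_sumr.
    apply: eq_bigr => k _; rewrite /vn.
    have -> : (- n.+1%:R^-1)%:C * w k = - w k / n.+1%:R.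
      by rewrite rmorphN fmorphV rmorph_nat mulrC; ring.
    by ring.
  apply: cvgC_sum => k; apply: cvgCM; [exact: expC_slope|exact: cvgC_cst].
have v0 := moments_eq0 vj (step _ vj) (step _ (step _ vj)).
have sec k : in_sector (w k).
  apply: zero_in_sector.
    rewrite mulf_neq0 // expf_neq0 //.
    by apply: contra_eq_neq om2 => ->; rewrite expr0n /= !addr0 oner_neq0.
  by apply/eqP; have /eqP := v0 k; rewrite mulf_eq0 (negPf (expC_neq0 _)) orbF.
have := sum_node_pow 1; rewrite /= mulr0.
rewrite !big_ord_recl big_ord0 => /(congr1 Re); rewrite !ReD !expr1 /=.
have [h0 _] := sec ord0; have [h1 _] := sec (lift ord0 ord0).
have [h2 _] := sec (lift ord0 (lift ord0 ord0)).
lra.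
Qed.

(** Summing over the cube roots of [z ^+ 3] keeps the exponents divisible by 3. *)
Lemma moment_section r : (r < 3)%N ->
  moment w (fun k => f (w k)) (3 - r)
    = 3 * z ^+ (3 - r) * psumC (realcoef (section_coef 3 r a)) z.
Proof.
move=> r3; set P := moment _ _ _.
have c0 : 3 * z ^+ (3 - r) != 0 by rewrite mulf_neq0 ?pnatr_eq0 // expf_neq0.
suff -> : psumC (realcoef (section_coef 3 r a)) z = (3 * z ^+ (3 - r))^-1 * P.
  by rewrite mulrA divff ?mul1r.
apply: psumCE.
have : cvgC (fun n => \sum_k pseriesC (realcoef a) (w k) n * w k ^+ (3 - r)) P.
  by apply: cvgC_sum => k; apply: cvgCM; [exact: psumC_cvg|exact: cvgC_cst].
move=> /(cvgCMl (3 * z ^+ (3 - r))^-1); congr cvgC; apply/funext => n.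
apply: (mulfI c0); rewrite mulrA divff // mul1r pseriesCE mulr_sumr.
under eq_bigr do rewrite pseriesCE mulr_suml.
rewrite exchange_big /=; apply: eq_bigr => j _.
under eq_bigr do rewrite -mulrA -exprD.
rewrite -mulr_sumr sum_node_pow.
have -> : (3 %| j + (3 - r))%N = (j == r %[mod 3]).
  by rewrite -(eqn_modDr (3 - r)) subnKC ?(ltnW r3) // modnn /dvdn.
rewrite /realcoef /section_coef; case: ifP => _; last by rewrite !mulr0 rmorph0 mul0r mulr0.
by rewrite exprD; ring.
Qed.

End Nodes.

End Zeros.

Lemma cube_root_of_unity (R : realType) : exists om : R[i], 1 + om + om ^+ 2 = 0.
Proof.
exists ((- (1 / 2)) +i* (Num.sqrt 3 / 2)).
have s3 : Num.sqrt 3 ^+ 2 = 3 :> R by rewrite sqr_sqrtr.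
apply/eqP; rewrite eq_complex /=; apply/andP; split; apply/eqP; last by field.
rewrite [LHS](_ : _ = (3 - Num.sqrt 3 ^+ 2) / 4); last by field.
by rewrite s3 subrr mul0r.
Qed.

Theorem theorem3 (R : realType) (a : nat -> R) (p : nat) (B : R) (C : R[i])
    (N : option nat) (zs : nat -> R[i])
    (f_entire : entire_coef (realcoef a))
    (zs_zeros : lists_nonzero_zeros (realcoef a) N zs)
    (prod_cvg : forall z : R[i],
       cvgn (list_prod N (fun j => primary_factor (zs j) z)))
    (factorization : forall z : R[i],
       psumC (realcoef a) z =
         z ^+ p * expC (B%:C * z + C)
         * limn (list_prod N (fun j => primary_factor (zs j) z)))
    (zs_Arg : forall j : nat, in_list N j ->
       2 * pi / 3 < `|Arg (zs j)| <= pi)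
    (sum_abs_cvg : cvgn (list_sum N (fun j => `|zs j|^-1)))
    (sum_pos : 0 < B + complex.Re (limn (list_sum N (fun j => (zs j)^-1))))
    (r : nat) (hr : (r < 3)%N) (z : R[i])
    (hz : psumC (realcoef (section_coef 3 r a)) z = 0) :
  complex.Im (z ^+ 3) = 0 /\ complex.Re (z ^+ 3) <= 0.
Proof.
have [->|z0] := eqVneq z 0; first by rewrite expr0n.
have secs j : in_list N j -> in_sector (zs j).
  by move=> jN; have /andP[h _] := zs_Arg j jN; apply: Arg_in_sector h; exact: zs_zeros.1.
have [om om2] := cube_root_of_unity R.
have nz := moment_nonzero f_entire zs_zeros prod_cvg factorization secs sum_abs_cvg sum_pos.
pose f := psumC (realcoef a).
pose w k : R[i] := z * om ^+ (k : 'I_3).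
have P0 : moment w (fun k => f (w k)) (3 - r) = 0.
  by rewrite moment_section // hz mulr0.
have P0J : moment (fun k : 'I_3 => z^* * om^* ^+ k) (fun k => f (z^* * om^* ^+ k)) (3 - r) = 0.
  transitivity ((moment w (fun k => f (w k)) (3 - r))^*); last by rewrite P0 rmorph0.
  rewrite /moment rmorph_sum /=; apply: eq_bigr => k _.
  have wJ : z^* * om^* ^+ k = (w k)^* by rewrite rmorphM rmorphXn.
  by rewrite wJ /f psumC_realcoefJ // [in RHS]rmorphM [in RHS]rmorphXn.
have om2J : 1 + om^* + om^* ^+ 2 = 0.
  transitivity ((1 + om + om ^+ 2)^*); last by rewrite om2 rmorph0.
  by rewrite !rmorphD rmorph1 rmorphXn.
have [ip|ip|i0] := ltrgtP (Im (z ^+ 3)) 0.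
- case: (nz om^* z^* om2J _ _ (3 - r)%N (sector_section_cone _)) => //.
    by rewrite conjc_eq0.
  by rewrite -rmorphXn ImJ oppr_gt0.
- by case: (nz om z om2 z0 _ (3 - r)%N (sector_section_cone ip)).
split=> //; rewrite leNgt; apply/negP => rp.
by case: (nz om z om2 z0 _ (3 - r)%N (real_section_cone i0 rp)).
Qed.
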